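(* Consider the finite volume discretization on cells of widths $\Delta x_i>0$, with constant $g>0$ and cell states $(h,v_1,v_2,B_1,B_2)_i$ with $h>0$, of the one-dimensional shallow water magnetohydrodynamic equations with source term $\vec{s}=-\partial_x(hB_1)\,(0,0,0,v_1,v_2)^T$. Suppose the source term is discretized to contribute to each cell $i$ as $$\vec{s}_i=-\frac12\left(\llbracket hB_1\rrbracket_{i+\frac12}\begin{bmatrix}0\\0\\0\\ \frac{\{\{v_1B_1\}\}}{\{\{\Delta x\,B_1\}\}}\\ \frac{\{\{v_2B_2\}\}}{\{\{\Delta x\,B_2\}\}}\end{bmatrix}_{i+\frac12}+\llbracket hB_1\rrbracket_{i-\frac12}\begin{bmatrix}0\\0\\0\\ \frac{\{\{v_1B_1\}\}}{\{\{\Delta x\,B_1\}\}}\\ \frac{\{\{v_2B_2\}\}}{\{\{\Delta x\,B_2\}\}}\end{bmatrix}_{i-\frac12}\right),$$ where the denominators are nonzero; that is, the interface $i+\frac12$ contributes $$\vec{\sigma}_{i+\frac12}=-\frac12\llbracket hB_1\rrbracket_{i+\frac12}\left(0,0,0,\frac{\{\{v_1B_1\}\}}{\{\{\Delta x B_1\}\}},\frac{\{\{v_2B_2\}\}}{\{\{\Delta x B_2\}\}}\right)^T_{i+\frac12}$$ to each of the two cells adjacent to it. Then $$\vec{f}^{*,ec}=\begin{bmatrix}\{\{h\}\}\{\{v_1\}\}\\ \{\{h\}\}\{\{v_1\}\}^2+\frac12 g\{\{h^2\}\}-\{\{hB_1\}\}\{\{B_1\}\}\\ \{\{h\}\}\{\{v_1\}\}\{\{v_2\}\}-\{\{hB_1\}\}\{\{B_2\}\}\\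 \{\{h\}\}\{\{v_1\}\}\{\{B_1\}\}-\{\{hB_1\}\}\{\{v_1\}\}\\ \{\{h\}\}\{\{v_1\}\}\{\{B_2\}\}-\{\{hB_1\}\}\{\{v_2\}\}\end{bmatrix}$$ is a (consistent) discrete entropy conservative numerical flux: $\vec{f}^{*,ec}$ equals the physical flux $\vec{f}$ when the left and right states coincide, and at every interface $$2\{\{\Delta x\,\vec{q}\}\}^T\vec{\sigma}_{i+\frac12}-\llbracket\vec{q}\cdot\vec{f}\rrbracket+\llbracket\vec{q}\rrbracket^T\vec{f}^{*,ec}=-\llbracket F\rrbracket .$$
   Context: The conserved variables are $\vec{u}=(h,hv_1,hv_2,hB_1,hB_2)^T$ and the physical flux is $\vec{f}=(hv_1,\;hv_1^2+\frac12 gh^2-hB_1^2,\;hv_1v_2-hB_1B_2,\;0,\;hv_1B_2-hv_2B_1)^T$; the equations are $\partial_t\vec{u}+\partial_x\vec{f}=\vec{s}$. The entropy function is $U=\frac12(gh^2+hv_1^2+hv_2^2+hB_1^2+hB_2^2)$, the entropy variables are $\vec{q}=\partial U/\partial\vec{u}=(gh-\frac12(v_1^2+v_2^2+B_1^2+B_2^2),\,v_1,\,v_2,\,B_1,\,B_2)^T$, and the entropy flux is $F=gh^2v_1+\frac12(hv_1^3+hv_1v_2^2+hv_1B_2^2-hv_1B_1^2)-hv_2B_1B_2$. At an interface between a left cell $L$ and a right cell $R$, write $\llbracket a\rrbracket=a_R-a_L$ and $\{\{a\}\}=\frac12(a_L+a_R)$ (also for products of quantities, e.g. $\{\{hB_1\}\}=\frac12(h_LB_{1,L}+h_RB_{1,R})$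 and $\{\{\Delta x B_1\}\}=\frac12(\Delta x_LB_{1,L}+\Delta x_RB_{1,R})$). The semi-discrete update restricted to one interface is $\Delta x_L\,\partial_t\vec{u}_L=\vec{f}_L-\vec{f}^*+\Delta x_L\vec{\sigma}$, $\Delta x_R\,\partial_t\vec{u}_R=\vec{f}^*-\vec{f}_R+\Delta x_R\vec{\sigma}$, where $\vec{f}^*=\vec{f}^*(\vec{u}_L,\vec{u}_R)$ is the numerical flux and $\vec{\sigma}$ is the contribution of the interface source to each adjacent cell. A numerical flux is required to be consistent: $\vec{f}^*(\vec{u},\vec{u})=\vec{f}(\vec{u})$. The flux is called entropy conservative if the resulting entropy update satisfies $\partial_t(\Delta x_LU_L+\Delta x_RU_R)=-\llbracket F\rrbracket$, i.e. if $2\{\{\Delta x\,\vec{q}\}\}^T\vec{\sigma}-\llbracket\vec{q}\cdot\vec{f}\rrbracket+\llbracket\vec{q}\rrbracket^T\vec{f}^*=-\llbracket F\rrbracket$. *)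

(* Defs.v *)
From HB Require Import structures.
From mathcomp Require Import all_boot all_order all_algebra.
From mathcomp Require Import reals.

Set Implicit Arguments.
Unset Strict Implicit.
Unset Printing Implicit Defensive.

Import Order.TTheory GRing.Theory Num.Theory.
Local Open Scope ring_scope.

(* Primitive variables. For h > 0 they are in bijection with the conserved
   variables (h, h v1, h v2, h B1, h B2), so every function of the conserved
   variables below is written as a function of a [state]. *)
Record state (R : realType) := State { h : R; v1 : R; v2 : R; B1 : R; B2 : R }.

Section SWMHD.
Context {R : realType}.
Implicit Types (g a b : R) (w wL wR : state R) (p q : 'cV[R]_5).

Definition vec5 (a0 a1 a2 a3 a4 : R) : 'cV[R]_5 :=
  \col_(i < 5) [:: a0; a1; a2; a3; a4]`_i.

Definition dotv p q : R := \sum_(i < 5) p i 0 * q i 0.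

(* Jump and arithmetic mean across an interface, left value first. *)
Definition jump (V : zmodType) (aL aR : V) : V := aR - aL.
Definition mean (aL aR : R) : R := 2^-1 * (aL + aR).
Definition vmean (aL aR : 'cV[R]_5) : 'cV[R]_5 := 2^-1 *: (aL + aR).

Definition flux g w : 'cV[R]_5 :=
  vec5 (h w * v1 w)
       (h w * v1 w ^+ 2 + 2^-1 * g * h w ^+ 2 - h w * B1 w ^+ 2)
       (h w * v1 w * v2 w - h w * B1 w * B2 w)
       0
       (h w * v1 w * B2 w - h w * v2 w * B1 w).

(* Gradient, in the conserved variables, of the entropy
   U = 1/2 (g h^2 + h v1^2 + h v2^2 + h B1^2 + h B2^2). *)
Definition entropy_vars g w : 'cV[R]_5 :=
  vec5 (g * h w - 2^-1 * (v1 w ^+ 2 + v2 w ^+ 2 + B1 w ^+ 2 + B2 w ^+ 2))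
       (v1 w) (v2 w) (B1 w) (B2 w).

Definition entropy_flux g w : R :=
  g * h w ^+ 2 * v1 w
  + 2^-1 * (h w * v1 w ^+ 3 + h w * v1 w * v2 w ^+ 2
            + h w * v1 w * B2 w ^+ 2 - h w * v1 w * B1 w ^+ 2)
  - h w * v2 w * B1 w * B2 w.

Definition jump_hB1 wL wR : R := jump (h wL * B1 wL) (h wR * B1 wR).

Definition mean_dxB1 (dxL dxR : R) wL wR : R := mean (dxL * B1 wL) (dxR * B1 wR).
Definition mean_dxB2 (dxL dxR : R) wL wR : R := mean (dxL * B2 wL) (dxR * B2 wR).

Definition source_dir (dxL dxR : R) wL wR : 'cV[R]_5 :=
  vec5 0 0 0
    (mean (v1 wL * B1 wL) (v1 wR * B1 wR) / mean_dxB1 dxL dxR wL wR)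
    (mean (v2 wL * B2 wL) (v2 wR * B2 wR) / mean_dxB2 dxL dxR wL wR).

(* Contribution of one interface to each of its two adjacent cells. *)
Definition interface_source (dxL dxR : R) wL wR : 'cV[R]_5 :=
  - 2^-1 * jump_hB1 wL wR *: source_dir dxL dxR wL wR.

(* Interface i + 1/2 separates cells i and i + 1. *)
Definition cell_source (dx : int -> R) (w : int -> state R) (i : int) :
    'cV[R]_5 :=
  - 2^-1 *: (jump_hB1 (w i) (w (i + 1))
               *: source_dir (dx i) (dx (i + 1)) (w i) (w (i + 1))
             + jump_hB1 (w (i - 1)) (w i)
               *: source_dir (dx (i - 1)) (dx i) (w (i - 1)) (w i)).

Definition flux_ec g wL wR : 'cV[R]_5 :=
  let mh := mean (h wL) (h wR) in
  let mv1 := mean (v1 wL) (v1 wR) in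
  let mv2 := mean (v2 wL) (v2 wR) in
  let mB1 := mean (B1 wL) (B1 wR) in
  let mB2 := mean (B2 wL) (B2 wR) in
  let mh2 := mean (h wL ^+ 2) (h wR ^+ 2) in
  let mhB1 := mean (h wL * B1 wL) (h wR * B1 wR) in
  vec5 (mh * mv1)
       (mh * mv1 ^+ 2 + 2^-1 * g * mh2 - mhB1 * mB1)
       (mh * mv1 * mv2 - mhB1 * mB2)
       (mh * mv1 * mB1 - mhB1 * mv1)
       (mh * mv1 * mB2 - mhB1 * mv2).

Definition consistent_flux g (fnum : state R -> state R -> 'cV[R]_5) : Prop :=
  forall w, 0 < h w -> fnum w w = flux g w.

(* The left-hand side is d/dt (dxL U_L + dxR U_R) along the update
   dxL u_L' = f_L - f* + dxL sigma,  dxR u_R' = f* - f_R + dxR sigma. *)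
Definition entropy_conservative_at g (fnum : state R -> state R -> 'cV[R]_5)
    (dxL dxR : R) wL wR (sigma : 'cV[R]_5) : Prop :=
  2 * dotv (vmean (dxL *: entropy_vars g wL) (dxR *: entropy_vars g wR)) sigma
  - jump (dotv (entropy_vars g wL) (flux g wL))
         (dotv (entropy_vars g wR) (flux g wR))
  + dotv (jump (entropy_vars g wL) (entropy_vars g wR)) (fnum wL wR)
  = - jump (entropy_flux g wL) (entropy_flux g wR).

End SWMHD.

(* Main.v *)
Require Import Defs.
From HB Require Import structures.
From mathcomp Require Import all_boot all_order all_algebra.
From mathcomp Require Import reals ring.

Set Implicit Arguments.
Unset Strict Implicit.
Unset Printing Implicit Defensive.

Import Order.TTheory GRing.Theory Num.Theory.
Local Open Scope ring_scope.

(** Contracting the physical flux with the entropy variables and removing the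
    entropy flux leaves the entropy potential
      psi = q . f - F = g h^2 v1 / 2 - h B1 (v . B), v . B = v1 B1 + v2 B2
    ([entropy_potentialE]). In terms of psi, entropy conservation at an
    interface reads
      [[q]] . f* + 2 {{dx q}} . sigma = [[psi]].

    Two contributions make up the right-hand side. In [[q]] . f* the kinetic
    and magnetic parts of the first component of [[q]] cancel the terms that
    carry {{h}} {{v1}} in the other components, because [[a^2]] / 2 is
    {{a}} [[a]]; what remains is g [[h^2 v1]] / 2 - {{h B1}} [[v . B]]
    ([jump_entropy_vars_dot_flux_ec]). It differs from [[psi]] by the
    half of the product rule for h B1 times v . B in which h B1 is differenced:
      [[h B1 (v . B)]] = {{h B1}} [[v . B]] + [[h B1]] {{v . B}}.
    The source supplies the missing half: its denominators are the
    dx-weighted means of B1 and B2, which are the factors by which the last two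
    components of {{dx q}} multiply it, so its work is
    - [[h B1]] {{v . B}} for any cell widths ([interface_source_work]). *)

Section EntropyConservation.
Context {R : realType}.
Implicit Types (g : R) (w wL wR : state R).

Lemma dotvE (p q : 'cV[R]_5) :
  dotv p q = p 0 0 * q 0 0 + p 1 0 * q 1 0 + p 2 0 * q 2 0
             + p 3 0 * q 3 0 + p 4 0 * q 4 0.
Proof.
rewrite /dotv !big_ord_recl big_ord0 addr0 !addrA.
by congr (_ + _ + _ + _ + _); congr (p _ _ * q _ _); apply: val_inj.
Qed.

Definition v_dot_B w : R := v1 w * B1 w + v2 w * B2 w.

Definition entropy_potential g w : R :=
  2^-1 * g * (h w ^+ 2 * v1 w) - h w * B1 w * v_dot_B w.

Lemma entropy_potentialE g w :
  dotv (entropy_vars g w) (flux g w) = entropy_flux g w + entropy_potential g w.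
Proof.
rewrite dotvE !mxE /= /entropy_flux /entropy_potential /v_dot_B.
by field.
Qed.

(** The product rule for jumps is exact, because each difference is weighted by
    the arithmetic mean of the other factor. *)
Lemma jumpM (aL aR bL bR : R) :
  jump (aL * bL) (aR * bR) = mean aL aR * jump bL bR + jump aL aR * mean bL bR.
Proof. by rewrite /jump /mean; field. Qed.

Lemma jump_entropy_vars_dot_flux_ec g wL wR :
  dotv (jump (entropy_vars g wL) (entropy_vars g wR)) (flux_ec g wL wR)
  = 2^-1 * g * jump (h wL ^+ 2 * v1 wL) (h wR ^+ 2 * v1 wR)
    - mean (h wL * B1 wL) (h wR * B1 wR) * jump (v_dot_B wL) (v_dot_B wR).
Proof.
rewrite dotvE !mxE /= /v_dot_B /jump /mean.
by field.
Qed.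

(** The last two entropy variables are B1 and B2 themselves, so {{dx q}} carries
    {{dx B1}} and {{dx B2}} there, which cancel the denominators of the source;
    the factor 2 counts the two cells that receive it. *)
Lemma interface_source_work g (dxL dxR : R) wL wR :
  mean_dxB1 dxL dxR wL wR != 0 -> mean_dxB2 dxL dxR wL wR != 0 ->
  2 * dotv (vmean (dxL *: entropy_vars g wL) (dxR *: entropy_vars g wR))
           (interface_source dxL dxR wL wR)
  = - (jump_hB1 wL wR * mean (v_dot_B wL) (v_dot_B wR)).
Proof.
move=> m1_neq0 m2_neq0.
rewrite dotvE !mxE /= !mulr0 !add0r.
rewrite -/(mean (dxL * B1 wL) (dxR * B1 wR)) -/(mean_dxB1 dxL dxR wL wR).
rewrite -/(mean (dxL * B2 wL) (dxR * B2 wR)) -/(mean_dxB2 dxL dxR wL wR).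
(* The weighted means stay opaque, so that they are single nonzero factors. *)
move: (mean_dxB1 _ _ _ _) (mean_dxB2 _ _ _ _) m1_neq0 m2_neq0 => m1 m2 ? ?.
rewrite /mean /v_dot_B.
by field; apply/andP.
Qed.

Lemma flux_ec_consistent g : consistent_flux g (flux_ec g).
Proof.
have meanxx a : mean a a = a by rewrite /mean; field.
move=> w _; rewrite /flux_ec !meanxx; congr vec5; ring.
Qed.

Lemma flux_ec_entropy_conservative g (dxL dxR : R) wL wR :
  mean_dxB1 dxL dxR wL wR != 0 -> mean_dxB2 dxL dxR wL wR != 0 ->
  entropy_conservative_at g (flux_ec g) dxL dxR wL wR
    (interface_source dxL dxR wL wR).
Proof.
move=> m1_neq0 m2_neq0; rewrite /entropy_conservative_at.
rewrite interface_source_work // jump_entropy_vars_dot_flux_ec.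
have jump_psi : jump (entropy_potential g wL) (entropy_potential g wR)
    = 2^-1 * g * jump (h wL ^+ 2 * v1 wL) (h wR ^+ 2 * v1 wR)
      - (mean (h wL * B1 wL) (h wR * B1 wR) * jump (v_dot_B wL) (v_dot_B wR)
         + jump_hB1 wL wR * mean (v_dot_B wL) (v_dot_B wR)).
  by rewrite /jump_hB1 -jumpM /jump /entropy_potential; ring.
rewrite !entropy_potentialE.
have -> (FL FR pL pR : R) : jump (FL + pL) (FR + pR) = jump FL FR + jump pL pR.
  by rewrite /jump; ring.
by rewrite jump_psi; ring.
Qed.

Lemma cell_source_split (dx : int -> R) (w : int -> state R) (i : int) :
  cell_source dx w i =
    interface_source (dx i) (dx (i + 1)) (w i) (w (i + 1))
    + interface_source (dx (i - 1)) (dx i) (w (i - 1)) (w i).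
Proof. by rewrite /cell_source /interface_source scalerDr !scalerA. Qed.

End EntropyConservation.

Theorem theorem1 (R : realType) (g : R) (dx : int -> R) (w : int -> state R)
  (g_gt0 : 0 < g)
  (dx_gt0 : forall i : int, 0 < dx i)
  (h_gt0 : forall i : int, 0 < h (w i))
  (dxB1_neq0 : forall i : int,
     mean_dxB1 (dx i) (dx (i + 1)) (w i) (w (i + 1)) != 0)
  (dxB2_neq0 : forall i : int,
     mean_dxB2 (dx i) (dx (i + 1)) (w i) (w (i + 1)) != 0) :
  [/\ forall i : int,
        cell_source dx w i =
          interface_source (dx i) (dx (i + 1)) (w i) (w (i + 1))
          + interface_source (dx (i - 1)) (dx i) (w (i - 1)) (w i),
      consistent_flux g (flux_ec g)
    & forall i : int,
        entropy_conservative_at g (flux_ec g)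
          (dx i) (dx (i + 1)) (w i) (w (i + 1))
          (interface_source (dx i) (dx (i + 1)) (w i) (w (i + 1)))].
Proof.
split=> [i||i].
- exact: cell_source_split.
- exact: flux_ec_consistent.
- exact: flux_ec_entropy_conservative.
Qed.
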